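(* There exists a topological dynamical system $(X,f)$ (that is, a non-empty compact metric space $(X,d)$ together with a continuous map $f:X\to X$) such that $X$ contains an infinite extremal distributionally $2$-scrambled set, but no triple $(x_1,x_2,x_3)\in X^3$ is $3$-scrambled.
   Context: Let $(X,d)$ be a non-empty compact metric space, $f:X\to X$ continuous, and $n\ge 2$. Put $\Delta^{(n)}=\{(x_1,\dots,x_n)\in X^n : x_i=x_j \text{ for some } i\neq j\}$. A tuple $(x_1,\dots,x_n)\in X^n$ is called $n$-scrambled if $$\liminf_{k\to\infty}\max_{1\le i<j\le n} d(f^k(x_i),f^k(x_j))=0 \quad\text{and}\quad \limsup_{k\to\infty}\min_{1\le i<j\le n} d(f^k(x_i),f^k(x_j))>0.$$ A scrambled triple is a $3$-scrambled tuple. For a tuple $(x_1,\dots,x_n)\in X^n$ define, for real $\delta$, the lower and upper distribution functions $$\Phi_{(x_1,\dots,x_n)}(\delta)=\liminf_{m\to\infty}\frac1m\#\{0<k<m : \min_{1\le i<j\le n} d(f^k(x_i),f^k(x_j))<\delta\},$$ $$\Phi^*_{(x_1,\dots,x_n)}(\delta)=\limsup_{m\to\infty}\frac1m\#\{0<k<m : \max_{1\le i<j\le n} d(f^k(x_i),f^k(x_j))<\delta\}.$$ The tuple is distributionally $n$-scrambled if $\Phi^*_{(x_1,\dots,x_n)}(\delta)=1$ for all $\delta>0$ and $\Phi_{(x_1,\dots,x_n)}(\delta)=0$ for some $0<\delta\le\operatorname{diam}X$. A subset $S\subset X$ is extremal distributionally $n$-scrambled if every tuple $(x_1,\dots,x_n)\in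 S^n\setminus\Delta^{(n)}$ is distributionally $n$-scrambled and satisfies $\Phi_{(x_1,\dots,x_n)}(\delta)=0$ for every $\delta<\operatorname{diam}X$. *)

(* Defs.v *)
From HB Require Import structures.
From mathcomp Require Import all_boot all_order all_algebra.
From mathcomp Require Import all_classical all_reals all_analysis.

Set Implicit Arguments.
Unset Strict Implicit.
Unset Printing Implicit Defensive.

Import Order.TTheory GRing.Theory Num.Theory.

Local Open Scope classical_set_scope.
Local Open Scope ring_scope.

Section Scrambled.
Context {R : realType} {X : metricType R}.

(* Extended-real valued, so that an unbounded space has diameter +oo. *)
Definition diam : \bar R :=
  ereal_sup [set (mdist p.1 p.2)%:E | p in [set: X * X]].

Definition fat_diagonal (n : nat) : set ('I_n -> X) :=
  [set x | exists i j : 'I_n, i <> j /\ x i = x j].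

(* Distances are nonnegative, so the neutral element 0 is harmless as soon as
   there is a pair i < j, i.e. for n >= 2. *)
Definition pair_max (n : nat) (x : 'I_n -> X) : R :=
  \big[Num.max/0]_(p : 'I_n * 'I_n | (p.1 < p.2)%N) mdist (x p.1) (x p.2).

(* The neutral element pair_max x bounds all the terms, so for n >= 2 this is
   the minimum of the distances over the pairs i < j. *)
Definition pair_min (n : nat) (x : 'I_n -> X) : R :=
  \big[Num.min/pair_max x]_(p : 'I_n * 'I_n | (p.1 < p.2)%N)
    mdist (x p.1) (x p.2).

Variable f : X -> X.

Definition orbit_tuple (n : nat) (x : 'I_n -> X) (k : nat) : 'I_n -> X :=
  fun i => iter k f (x i).

Definition scrambled (n : nat) (x : 'I_n -> X) : Prop :=
  limn_einf (fun k => (pair_max (orbit_tuple x k))%:E) = 0%E /\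
  (0 < limn_esup (fun k => (pair_min (orbit_tuple x k))%:E))%E.

(* The value at m = 0 is 0, which is irrelevant for limits as m goes to oo. *)
Definition frequency (P : pred nat) (m : nat) : R :=
  #|[pred k : 'I_m | (0 < k)%N && P k]|%:R / m%:R.

Definition lower_distribution (n : nat) (x : 'I_n -> X) (delta : R) : \bar R :=
  limn_einf (fun m =>
    (frequency (fun k => pair_min (orbit_tuple x k) < delta) m)%:E).

Definition upper_distribution (n : nat) (x : 'I_n -> X) (delta : R) : \bar R :=
  limn_esup (fun m =>
    (frequency (fun k => pair_max (orbit_tuple x k) < delta) m)%:E).

Definition dist_scrambled (n : nat) (x : 'I_n -> X) : Prop :=
  (forall delta : R, 0 < delta -> upper_distribution x delta = 1%E) /\
  (exists delta : R, [/\ 0 < delta, (delta%:E <= diam)%E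
                       & lower_distribution x delta = 0%E]).

Definition extremal_dist_scrambled (n : nat) (S : set X) : Prop :=
  forall x : 'I_n -> X, (forall i, S (x i)) -> ~ fat_diagonal x ->
    dist_scrambled x /\
    (forall delta : R, (delta%:E < diam)%E ->
       lower_distribution x delta = 0%E).

End Scrambled.

(* Main.v *)
Require Import Defs.
From HB Require Import structures.
From mathcomp Require Import all_boot all_order all_algebra.
From mathcomp Require Import all_classical all_reals all_analysis.
From mathcomp Require Import zify lra.

Import Order.TTheory GRing.Theory Num.Theory.
Import numFieldNormedType.Exports.

Local Open Scope classical_set_scope.
Local Open Scope ring_scope.

(* The system is the segment [0, 1], made of fixed points, together with
   countably many orbits of isolated points accumulating on it. In each time
   block [n!, (n+1)!) a single orbit, the one labelled by the 2-adic valuation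
   of n, travels slowly from 0 to 1, rests there for most of the block and
   returns to 0, while all the other orbits hover over 0. Two orbits are thus
   at distance 1 during most of the blocks carrying one of their labels, and
   close together during all blocks carrying a third label, while the blocks
   grow fast enough for each to have density close to 1 at its end. As the
   steps tend to 0, a point is asymptotic to its image, so time shifts along
   an orbit do not matter; and at any time two out of three distinct orbits
   hover over 0. A tuple made of two orbits and a fixed point c is proximal
   only if c = 0, and then the same argument applies. Hence three points that
   are simultaneously proximal always have two of them close together. *)

Lemma exists_natr_gt {R : archiRealFieldType} (r : R) :
  exists n : nat, r < n%:R.
Proof. by exists (Num.truncn r).+1; exact: truncnS_gt. Qed.

(** * Bounds on upper and lower limits of real sequences *)

Section Limits.
Context {R : realType}.
Implicit Types (u : nat -> R) (l : R).

Lemma limn_esup_le u l N : (forall m, (N <= m)%N -> u m <= l) ->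
  (limn_esup (fun m => (u m)%:E) <= l%:E)%E.
Proof.
move=> uN; apply: (@le_trans _ _ (ereal_sup
    ((fun m => (u m)%:E) @` [set m | (N <= m)%N]))).
  by apply: ereal_inf_lbound; exists [set m | (N <= m)%N] => //; exists N.
by apply: ge_ereal_sup => _ [m /= Nm <-]; rewrite lee_fin uN.
Qed.

Lemma le_limn_esup u l : (forall N, exists2 m, (N <= m)%N & l <= u m) ->
  (l%:E <= limn_esup (fun m => (u m)%:E))%E.
Proof.
move=> ul; apply: le_ereal_inf_tmp => _ [V [N _ NV] <-].
have [m Nm lum] := ul N.
apply: (@le_trans _ _ (u m)%:E); first by rewrite lee_fin.
by apply: ereal_sup_ubound; exists m => //; exact: NV.
Qed.

(** This unfolds the definition, so that each bound on a lower limit follows from the dual bound on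
    an upper limit. *)
Lemma limn_einf_EFin u :
  limn_einf (fun m => (u m)%:E) = (- limn_esup (fun m => (- u m)%:E))%E.
Proof. by []. Qed.

Lemma limn_einf_le u l : (forall N, exists2 m, (N <= m)%N & u m <= l) ->
  (limn_einf (fun m => (u m)%:E) <= l%:E)%E.
Proof.
move=> ul; rewrite limn_einf_EFin leeNl; apply: le_limn_esup => N.
by have [m Nm uml] := ul N; exists m => //; rewrite lerN2.
Qed.

Lemma le_limn_einf u l N : (forall m, (N <= m)%N -> l <= u m) ->
  (l%:E <= limn_einf (fun m => (u m)%:E))%E.
Proof.
move=> uN; rewrite limn_einf_EFin leeNr; apply: (limn_esup_le _ _ N) => m Nm.
by rewrite lerN2 uN.
Qed.

End Limits.

(** * Counting estimates for frequencies *)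

Section Frequency.
Context {R : realType}.

Lemma frequency_ge0 (P : pred nat) m : 0 <= frequency P m :> R.
Proof. by rewrite /frequency divr_ge0. Qed.

Lemma frequency_le1 (P : pred nat) m : frequency P m <= 1 :> R.
Proof.
rewrite /frequency; case: m => [|m]; first by rewrite invr0 mulr0.
by rewrite ler_pdivrMr// mul1r ler_nat (leq_trans (max_card _))// card_ord.
Qed.

Lemma frequency_le (P : pred nat) (a m : nat) :
  (forall k, (k < m)%N -> P k -> (k < a)%N) ->
  frequency P m <= a%:R / m%:R :> R.
Proof.
move=> Pa; rewrite ler_wpM2r// ler_nat cardE -(size_map val).
rewrite -[leqRHS](size_iota 0); apply: uniq_leq_size.
  by rewrite map_inj_uniq ?enum_uniq//; exact: val_inj.
move=> _ /mapP[k + ->]; rewrite mem_enum inE mem_iota => /andP[_ Pk].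
by rewrite /= add0n Pa.
Qed.

(** Positivity of [a] keeps the time 0, which [frequency] never counts, out of the range where [P]
    holds. *)
Lemma frequency_ge (P : pred nat) (a m : nat) : (0 < a <= m)%N ->
  (forall k, (a <= k < m)%N -> P k) ->
  1 - a%:R / m%:R <= frequency P m :> R.
Proof.
move=> /andP[a0 am] aP; have m0 : (0 < m)%N by apply: leq_trans am.
rewrite /frequency lerBlDr -mulrDl -natrD ler_pdivlMr ?ltr0n// mul1r ler_nat.
rewrite addnC -leq_subLR.
rewrite cardE -(size_map val) -[leqLHS](size_iota a)/=; apply: uniq_leq_size.
  exact: iota_uniq.
move=> k; rewrite mem_iota subnKC// => /= /andP[ak km].
apply/mapP; exists (Ordinal km) => //; rewrite mem_enum inE/=.
by rewrite (leq_trans a0 ak)/= aP// ak.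
Qed.

End Frequency.

(** * Extremal pairwise distances of a tuple *)

Section Pairs.
Context {R : realType} {X : metricType R}.

Lemma le_pair_max n (x : 'I_n -> X) i j : i != j ->
  mdist (x i) (x j) <= pair_max x.
Proof.
wlog ij : i j / (i < j)%N.
  move=> wl inj; have [ij|ji|/val_inj/eqP] := ltngtP i j; first exact: wl.
    by rewrite metric_sym; apply: wl; rewrite // eq_sym.
  by rewrite (negPf inj).
by move=> _; rewrite /pair_max (le_bigmax_cond _
  (fun p : 'I_n * 'I_n => mdist (x p.1) (x p.2)) (j := (i, j))).
Qed.

Lemma pair_min_le n (x : 'I_n -> X) i j : i != j ->
  pair_min x <= mdist (x i) (x j).
Proof.
wlog ij : i j / (i < j)%N.
  move=> wl inj; have [ij|ji|/val_inj/eqP] := ltngtP i j; first exact: wl.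
    by rewrite metric_sym; apply: wl; rewrite // eq_sym.
  by rewrite (negPf inj).
by move=> _; rewrite /pair_min (bigmin_le_cond _
  (fun p : 'I_n * 'I_n => mdist (x p.1) (x p.2)) (j := (i, j))).
Qed.

Lemma ord2_lt (i j : 'I_2) : (i < j)%N -> i = ord0 /\ j = ord_max.
Proof.
by case: i j => -[|[]]// ? [[|[]]]// ? _; split; apply: val_inj.
Qed.

Lemma pair_max2 (x : 'I_2 -> X) : pair_max x = mdist (x ord0) (x ord_max).
Proof.
apply/eqP; rewrite eq_le le_pair_max// andbT; apply: bigmax_le => [|[i j]/= ij].
  exact: mdist_ge0.
by have [-> ->] := ord2_lt i j ij.
Qed.

Lemma pair_min2 (x : 'I_2 -> X) : pair_min x = mdist (x ord0) (x ord_max).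
Proof.
apply/eqP; rewrite eq_le pair_min_le//=; apply: le_bigmin => [|[i j]/= ij].
  by rewrite pair_max2.
by have [-> ->] := ord2_lt i j ij.
Qed.

End Pairs.

(** * Factorial time blocks; index 0 is the default of an empty maximum and occurs only at
    [k = 0] *)

Definition block (k : nat) : nat := \max_(n < k.+1 | (n`! <= k)%N) n.

Lemma leq_block n k : (n`! <= k)%N -> (n <= block k)%N.
Proof.
move=> nk; have nk1 : (n < k.+1)%N.
  by rewrite ltnS (leq_trans _ nk)// fact_geq.
exact: (@leq_bigmax_cond _ _ _ (Ordinal nk1)).
Qed.

Lemma block_leq n k : (k < n.+1`!)%N -> (block k <= n)%N.
Proof.
move=> kn; apply/bigmax_leqP => i ik; rewrite leqNgt; apply/negP => ni.
by have := leq_trans (leq_trans kn (leq_fact ni)) ik; rewrite ltnn.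
Qed.

Lemma block_eq n k : (n`! <= k < n.+1`!)%N -> block k = n.
Proof.
by move=> /andP[nk kn]; apply/eqP; rewrite eqn_leq leq_block// block_leq.
Qed.

Lemma block_bounds k : (0 < k)%N -> ((block k)`! <= k < (block k).+1`!)%N.
Proof.
move=> k0; apply/andP; split; last first.
  by rewrite ltnNge; apply/negP => /leq_block; rewrite ltnn.
rewrite /block; elim/big_ind: _ => // m n mk nk.
by case: (leqP m n).
Qed.

(** * Height of travel of an orbit over the segment, as a function of time *)

Section Profile.
Context {R : realType}.

Lemma ler_dist_min (a b c d e : R) : `|a - c| <= e -> `|b - d| <= e ->
  `|Num.min a b - Num.min c d| <= e.
Proof.
rewrite !ler_norml => /andP[? ?] /andP[? ?].
by case: (ltP a b); case: (ltP c d) => ? ?; apply/andP; split; lra.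
Qed.

(* Truncated subtraction gives hump 0 0 = 0 at k = 0, which lies in no block. *)
Definition hump (n k : nat) : R :=
  Num.min 1 (Num.min ((k - n`!)%N%:R / n`!%:R) ((n.+1`! - k)%N%:R / n`!%:R)).

Definition profile (i k : nat) : R :=
  if logn 2 (block k) == i then hump (block k) k else 0.

Lemma hump_ge0 n k : 0 <= hump n k.
Proof. by rewrite /hump !le_min ler01 !divr_ge0. Qed.

Lemma hump_le1 n k : hump n k <= 1.
Proof. by rewrite /hump ge_min lexx. Qed.

Lemma profile_ge0 i k : 0 <= profile i k.
Proof. by rewrite /profile; case: ifP => // _; exact: hump_ge0. Qed.

Lemma profile_le1 i k : profile i k <= 1.
Proof. by rewrite /profile; case: ifP => // _; exact: hump_le1. Qed.

(** A block index has only one 2-adic valuation, so only one label can be active. *)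
Lemma profile_disjoint i j k : i <> j -> profile i k = 0 \/ profile j k = 0.
Proof.
rewrite /profile => ij; case: eqP => [bi|]; last by left.
by case: eqP => [bj|]; [rewrite bi in bj|right].
Qed.

Lemma hump_fact n : hump n n`! = 0.
Proof.
by rewrite /hump subnn mul0r (min_l (y := (_ - _)%N%:R / _)) ?divr_ge0// min_r.
Qed.

(** The ascent and the descent take [n!] steps each, and the descent starts at
    [(n+1)! - n! = n * n!]. *)
Lemma hump_plateau n k : (2 * n`! <= k <= n * n`!)%N -> hump n k = 1.
Proof.
move=> /andP[ak kb]; have n0 : (0 : R) < n`!%:R by rewrite ltr0n fact_gt0.
apply/min_l; rewrite le_min !ler_pdivlMr// !mul1r !ler_nat factS.
by apply/andP; split; lia.
Qed.

Lemma profile_plateau n k : (0 < n)%N -> (2 * n`! <= k <= n * n`!)%N ->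
  profile (logn 2 n) k = 1.
Proof.
move=> n0 nk; have bk : block k = n.
  by apply: block_eq; rewrite factS; have := fact_gt0 n; nia.
by rewrite /profile bk eqxx hump_plateau.
Qed.

Lemma profile_eq0 i n k : logn 2 n <> i -> (n`! <= k < n.+1`!)%N ->
  profile i k = 0.
Proof. by move=> ni nk; rewrite /profile (block_eq n k nk); case: eqP. Qed.

(** The valuation of the block index is at most that index, hence at most [k]. This makes
    [profile_slow] uniform in the label. *)
Lemma profile_eq0_early i k : (k < i)%N -> profile i k = 0.
Proof.
move=> ki; rewrite /profile; case: eqP => // bi; move: ki.
have : (block k <= k)%N.
  by apply/bigmax_leqP => j _; rewrite -ltnS.
have [b0|b0] := posnP (block k); first by rewrite -bi b0.
have := ltn_logl 2 b0; lia.
Qed.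

(** Both slopes of a hump are [1/n!] in absolute value, and taking minima does not increase
    variations. *)
Lemma profile_step i k : (0 < k)%N ->
  `|profile i k.+1 - profile i k| <= (block k)`!%:R^-1.
Proof.
move=> k0; have /andP[nk kn] := block_bounds k k0.
set n := block k in nk kn *.
have n0 : (0 : R) < n`!%:R^-1 by rewrite invr_gt0 ltr0n fact_gt0.
(* At the last instant of a block the value is at most [1/n!], and the next block starts at 0. *)
have := kn; rewrite leq_eqVlt => /orP[/eqP kn1|kn1].
  have -> : profile i k.+1 = 0.
    rewrite /profile (block_eq n.+1); last first.
      by rewrite kn1 leqnn ltn_fact.
    by rewrite kn1 hump_fact if_same.
  rewrite sub0r normrN ger0_norm ?profile_ge0//.
  rewrite /profile; case: ifP => _; last exact: ltW.
  by rewrite /hump -/n !ge_min -kn1 subSnn mul1r lexx !orbT.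
rewrite /profile (block_eq n k.+1) ?kn1 1?leqW// -/n.
case: ifP => _; last by rewrite subrr normr0 ltW.
rewrite /hump subSn// -[(k - n`!).+1%:R]natr1 mulrDl mul1r.
have -> : (n.+1`! - k = (n.+1`! - k.+1).+1)%N by lia.
rewrite -[(n.+1`! - k.+1).+1%:R]natr1 mulrDl mul1r.
set a := (k - _)%N%:R / _; set b := (_ - k.+1)%N%:R / _.
apply: ler_dist_min; first by rewrite subrr normr0 ltW.
by apply: ler_dist_min; rewrite ?(addrC a) ?(addrC b) ?opprD ?addrK ?addrNK
  ?addKr ?normrN ger0_norm ?(ltW n0).
Qed.

Lemma profile_slow (e : R) : 0 < e -> exists N : nat,
  forall i k, (N <= i + k)%N -> `|profile i k.+1 - profile i k| < e.
Proof.
(* If [i <= k + 1], then [i + k <= 2k + 1], so this threshold forces [n! <= k]; otherwise both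
   values vanish. *)
move=> e0; have [n en] := exists_natr_gt e^-1; exists (n`! + n`!).+1 => i k Nik.
have [ki|ik] := ltnP k.+1 i.
  by rewrite !profile_eq0_early// 1?ltnW// subrr normr0.
have nk : (n`! <= k)%N by lia.
have k0 : (0 < k)%N by rewrite (leq_trans _ nk) ?fact_gt0.
apply: (le_lt_trans (profile_step i k k0)).
rewrite invf_plt ?posrE ?ltr0n ?fact_gt0//.
rewrite (lt_le_trans en)// ler_nat.
by rewrite (leq_trans (leq_block _ _ nk))// fact_geq.
Qed.

End Profile.

(** * The phase space: metric, continuity of the map, compactness *)

Lemma mdist_continuous {R : realType} {X Y : metricType R} (f : X -> Y) :
  (forall x e, 0 < e -> exists2 d, 0 < d &
    forall y, mdist x y < d -> mdist (f x) (f y) < e) -> continuous f.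
Proof.
move=> fP x; apply/cvg_ballP => e e0; apply/nbhs_ballP.
have [d d0 dP] := fP x e e0; exists d => // y.
by rewrite !ballEmdist; exact: dP.
Qed.

(* The left summand is the segment of fixed points; [inr (i, k)] is the k-th
   point of the i-th orbit. *)
Definition strip (R : realType) : Type :=
  ({c : R | 0 <= c <= 1} + nat * nat)%type.

HB.instance Definition _ (R : realType) :=
  Choice.copy (strip R) ({c : R | 0 <= c <= 1} + nat * nat)%type.

Section Strip.
Context {R : realType}.
Implicit Types x y z : strip R.

Definition foot x : R :=
  match x with inl c => val c | inr ik => profile ik.1 ik.2 end.

(** Only finitely many points lie above any positive level, which is what makes the space
    compact. *)
Definition height x : R :=
  match x with inl _ => 0 | inr ik => (ik.1 + ik.2).+1%:R^-1 end.

Definition advance x : strip R :=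
  match x with inl c => inl c | inr ik => inr (ik.1, ik.2.+1) end.

(* Letting heights bound the distance from below isolates the points [inr _], so
   their positions (foot, height) need not be distinct. *)
Definition strip_dist x y : R :=
  if x == y then 0 else
  Num.max `|foot x - foot y| (Num.max (height x) (height y)).

Lemma foot_ge0 x : 0 <= foot x.
Proof. by case: x => [[c /= /andP[]]|ik]//; exact: profile_ge0. Qed.

Lemma foot_le1 x : foot x <= 1.
Proof. by case: x => [[c /= /andP[]]|ik]//; exact: profile_le1. Qed.

Lemma height_ge0 x : 0 <= height x.
Proof. by case: x => //= ik; rewrite invr_ge0. Qed.

Lemma height_le1 x : height x <= 1.
Proof. by case: x => //= ik; rewrite invf_le1 ?ler1n. Qed.

Lemma height_advance x : height (advance x) <= height x.
Proof. by case: x => //= ik; rewrite lef_pV2 ?posrE// ler_nat; lia. Qed.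

Fact strip_distxx x : strip_dist x x = 0.
Proof. by rewrite /strip_dist eqxx. Qed.

Fact strip_dist_eq0 x y : strip_dist x y = 0 -> x = y.
Proof.
rewrite /strip_dist; case: eqVneq => // xy d0.
have [f0 hx0 hy0] : [/\ `|foot x - foot y| <= 0, height x <= 0 & height y <= 0].
  by split; rewrite -d0 !le_max lexx ?orbT.
(* Zero height places both points on the segment, where the foot determines the point. *)
case: x y xy f0 hx0 hy0 {d0} => [c|ik] [c'|ik']//= _.
- by rewrite normr_le0 subr_eq0 => /eqP /val_inj ->.
- by move=> _ _; rewrite invr_le0 lern0.
- by move=> _; rewrite invr_le0 lern0.
- by move=> _; rewrite invr_le0 lern0.
Qed.

Fact strip_dist_sym x y : strip_dist x y = strip_dist y x.
Proof.
by rewrite /strip_dist eq_sym distrC [Num.max (height x) _]maxC.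
Qed.

Fact strip_dist_triangle y x z :
  strip_dist x z <= strip_dist x y + strip_dist y z.
Proof.
have d0 u v : 0 <= strip_dist u v.
  by rewrite /strip_dist; case: eqP => // _; rewrite le_max normr_ge0.
have [->|xz] := eqVneq x z; first by rewrite strip_distxx addr_ge0.
have [->|xy] := eqVneq x y; first by rewrite strip_distxx add0r.
have [<-|yz] := eqVneq y z; first by rewrite strip_distxx addr0.
rewrite {1}/strip_dist (negPf xz) !ge_max.
have [a1 a2] : `|foot x - foot y| <= strip_dist x y /\
  height x <= strip_dist x y.
  by rewrite /strip_dist (negPf xy) !le_max !lexx ?orbT.
have [b1 b2] : `|foot y - foot z| <= strip_dist y z /\
  height z <= strip_dist y z.
  by rewrite /strip_dist (negPf yz) !le_max !lexx ?orbT.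
have := ler_distD (foot y) (foot x) (foot z).
have := d0 x y; have := d0 y z.
by move=> *; apply/and3P; split; lra.
Qed.

HB.instance Definition _ := isMetric.Build R (strip R)
  strip_distxx strip_dist_eq0 strip_dist_sym strip_dist_triangle.

Lemma mdist_stripE x y : mdist x y = strip_dist x y. Proof. by []. Qed.

Lemma foot_le_mdist x y : `|foot x - foot y| <= mdist x y.
Proof.
rewrite mdist_stripE /strip_dist; case: eqVneq => [->|_].
  by rewrite subrr normr0.
by rewrite le_max lexx.
Qed.

Lemma mdist_le x y :
  mdist x y <= Num.max `|foot x - foot y| (Num.max (height x) (height y)).
Proof.
rewrite mdist_stripE /strip_dist.
by case: eqP => // _; rewrite le_max normr_ge0.
Qed.

Lemma mdist_le1 x y : mdist x y <= 1.
Proof.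
apply: le_trans (mdist_le x y) _; rewrite !ge_max !height_le1 !andbT.
have := (foot_ge0 x, foot_le1 x, foot_ge0 y, foot_le1 y).
by move=> [[[? ?] ?] ?]; rewrite ler_norml; apply/andP; split; lra.
Qed.

Lemma iter_advance_inl c k : iter k advance (inl c) = inl c.
Proof. by elim: k => //= k ->. Qed.

Lemma iter_advance_inr i l k : iter k advance (inr (i, l)) = inr (i, (l + k)%N).
Proof. by elim: k => [|k /= ->]; rewrite ?addn0 ?addnS. Qed.

Lemma height_iter x k : height (iter k advance x) <= k.+1%:R^-1.
Proof.
case: x => [c|[i l]]; first by rewrite iter_advance_inl invr_ge0.
by rewrite iter_advance_inr /= lef_pV2 ?posrE// ler_nat; lia.
Qed.

(** Orbit points are isolated. An orbit point near the segment has large [i + k], so one step hardly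
    moves its foot. *)
Lemma advance_continuous : continuous advance.
Proof.
apply: mdist_continuous => x e e0.
case: x => [c|ik]; last first.
  (* Every other point is at least this far away. *)
  exists (height (inr ik)) => /=; first by rewrite invr_gt0.
  move=> y; rewrite {1}mdist_stripE /strip_dist.
  case: eqVneq => [<- _|_]; first by rewrite mdistxx.
  by rewrite !gt_max ltxx andbF.
have [N NP] := @profile_slow R _ (divr_gt0 e0 (ltr0Sn _ 1)).
(* The first bound forces [N <= i + k] through the height; the second leaves [e / 2] for the motion
   of the foot. *)
exists (Num.min N.+1%:R^-1 (e / 2)) => /=.
  by rewrite lt_min invr_gt0 ltr0n divr_gt0.
move=> y; rewrite lt_min => /andP[dN de].
case: y dN de => [c'|[i k]] dN de; first by apply: lt_trans de _; lra.
apply: le_lt_trans (mdist_le _ _) _; rewrite !gt_max e0 /=.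
have hd : (i + k).+1%:R^-1 <= mdist (inl c : strip R) (inr (i, k)).
  by rewrite mdist_stripE /strip_dist /= !le_max lexx !orbT.
have := foot_le_mdist (inl c) (inr (i, k)) => /= fd.
have Nik : (N <= i + k)%N.
  have := le_lt_trans hd dN; rewrite ltf_pV2 ?posrE// ltr_nat; lia.
have := NP _ _ Nik.
have := le_lt_trans (le_trans (height_advance (inr (i, k))) hd) de => /=.
have := ler_distD (profile i k) (sval c) (profile i k.+1).
rewrite [`|profile i k - profile i k.+1|]distrC => ? he ?.
apply/andP; split; first by lra.
by apply: lt_trans he _; lra.
Qed.

(** Along an ultrafilter either the heights tend to 0, and it converges to the segment point given
    by the limit of the feet, or it contains a finite set of points of height at least some
    [e > 0]. *)
Lemma strip_compact : compact [set: strip R].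
Proof.
rewrite compact_ultra => F UF _.
have [Fh|] := pselect (forall e : R, 0 < e -> F [set x | height x < e]).
  have F01 : F (foot @^-1` `[0, 1]%classic).
    by apply: filterE => x /=; rewrite in_itv/= foot_ge0 foot_le1.
  have [c [c01 Fc]] := @segment_compact R 0 1 _ (fmap_proper_filter foot _) F01.
  (* For an ultrafilter the cluster point [c] of the feet is a limit. *)
  have Fnear B : nbhs c B -> F (foot @^-1` B).
    move=> cB; have [//|FnB] := in_ultra_setVsetC (foot @^-1` B) UF.
    by have [z []] := Fc (~` B) B FnB cB.
  have c01' : 0 <= c <= 1 by move: c01; rewrite /= in_itv.
  exists (inl (exist _ c c01')); split => //.
  apply/metricType_numDomainType.fcvgrPdist_lt => e e0; near=> x.
  apply: le_lt_trans (mdist_le _ _) _.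
  rewrite !gt_max e0 /=; apply/andP; split.
    near: x; apply: (Fnear [set r | `|c - r| < e]).
    by apply/nbhs_ballP; exists e.
  by near: x; exact: Fh.
move=> /existsNP[e /not_implyP[e0 nFe]].
pose A := [set x | e <= height x].
have FA : F A.
  have [//|Fc] := in_ultra_setVsetC A UF.
  exfalso; apply: nFe; apply: filterS Fc => x; rewrite /A /= => /negP.
  by rewrite -ltNge.
have Afin : finite_set A.
  have [N eN] := exists_natr_gt e^-1.
  apply: (@sub_finite_set _ _ ((fun ik => inr ik) @` (`I_N `*` `I_N))).
    case=> [c|[i k]] /= eh; first by move: eh; rewrite /A /= leNgt e0.
    have ikN : (i + k < N)%N.
      apply: ltnW; rewrite -(ltr_nat R) (le_lt_trans _ eN)//.
      by rewrite -[leLHS]invrK lef_pV2 ?posrE ?invr_gt0.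
    by exists (i, k) => //=; split => /=; lia.
  by apply: finite_image; apply: finite_setX; exact: finite_II.
have := finite_compact Afin; rewrite compact_ultra => /(_ F UF FA)[p [_ Fp]].
by exists p.
Unshelve. all: by end_near. Qed.

End Strip.

(** Odd multiples of [2 ^ i] give every label arbitrarily late blocks. *)
Lemma logn2_unbounded i N : exists n, [/\ (N <= n)%N, (0 < n)%N & logn 2 n = i].
Proof.
have e0 : (0 < 2 ^ i)%N by rewrite expn_gt0.
exists (2 ^ i * (N.*2).+1)%N; split; [by nia | by rewrite muln_gt0 e0 |].
by rewrite lognM// pfactorK// logn_coprime ?addn0// coprime2n /= odd_double.
Qed.

(** * Asymptotics of orbits and absence of scrambled triples *)

Section Dynamics.
Context {R : realType}.
Implicit Types x y z : strip R.

(* [foot (iter k advance x)] up to o(1); the starting index on an orbit is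
   forgotten. *)
Definition shade x (k : nat) : R :=
  match x with inl c => val c | inr ik => profile ik.1 k end.

Lemma foot_shade x (e : R) : 0 < e -> exists N, forall k, (N <= k)%N ->
  `|foot (iter k advance x) - shade x k| <= e.
Proof.
move=> e0; case: x => [c|[i l]].
  by exists 0%N => k _; rewrite iter_advance_inl subrr normr0 ltW.
(* Forgetting the starting index costs [l] steps of this size, hence at most [e] in total. *)
have [|N NP] := @profile_slow R (e / l.+1%:R); first by rewrite divr_gt0.
exists N => k Nk; rewrite iter_advance_inr /=.
have : `|profile i (l + k) - profile i k| <= e / l.+1%:R *+ l.
  elim: {-2}l => [|j IH]; first by rewrite add0n subrr normr0.
  rewrite mulrS (le_trans (ler_distD (profile i (j + k)) _ _))// lerD//.
  by apply/ltW; rewrite addSn; apply: NP;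
    rewrite addnA (leq_trans Nk)// leq_addl.
move/le_trans; apply; rewrite -mulr_natr mulrAC ler_pdivrMr//.
by rewrite ler_wpM2l ?ler_nat// ltW.
Qed.

Lemma shade_eq_mdist x y (e : R) : 0 < e -> exists N, forall k, (N <= k)%N ->
  shade x k = shade y k -> mdist (iter k advance x) (iter k advance y) <= e.
Proof.
move=> e0; have e20 : 0 < e / 2 by rewrite divr_gt0.
have [N NP] := foot_shade x _ e20; have [M MP] := foot_shade y _ e20.
have [a ea] := exists_natr_gt e^-1; exists (N + M + a)%N => k NMk xy.
have NPk := NP k ltac:(lia); have MPk := MP k ltac:(lia).
have hk : k.+1%:R^-1 <= e.
  rewrite -[leRHS]invrK lef_pV2 ?posrE ?invr_gt0//.
  by rewrite (le_trans (ltW ea))// ler_nat; lia.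
apply: (le_trans (mdist_le _ _)).
rewrite !ge_max !(le_trans (height_iter _ _) hk) !andbT.
apply: (le_trans (ler_distD (shade x k) _ _)).
by rewrite [leRHS]splitr lerD// xy distrC.
Qed.

Lemma shade_neq_mdist x y (r : R) : 0 < r -> exists N, forall k, (N <= k)%N ->
  r <= `|shade x k - shade y k| ->
  r / 2 <= mdist (iter k advance x) (iter k advance y).
Proof.
(* Passing from the two shades to the two feet loses [r / 4] each, which leaves [r / 2]. *)
move=> r0; have r40 : 0 < r / 4 by rewrite divr_gt0.
have [N NP] := foot_shade x _ r40; have [M MP] := foot_shade y _ r40.
exists (N + M)%N => k NMk xy.
have := NP k ltac:(lia); have := MP k ltac:(lia).
have := foot_le_mdist (iter k advance x) (iter k advance y).
have := ler_distD (foot (iter k advance x)) (shade x k) (shade y k).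
have := ler_distD (foot (iter k advance y)) (foot (iter k advance x))
  (shade y k).
rewrite [`|shade x k - foot _|]distrC; lra.
Qed.

(** Among three orbits two shades always agree, and distinct constants stay apart. A constant [c]
    with two orbits of different labels meets one of them at each time if [c = 0], and otherwise is
    [|c|] away from whichever is over 0. *)
Lemma shade_triple x y z :
  (forall k, [\/ shade x k = shade y k, shade x k = shade z k |
                 shade y k = shade z k]) \/
  exists2 r : R, 0 < r & forall k, [\/ r <= `|shade x k - shade y k|,
    r <= `|shade x k - shade z k| | r <= `|shade y k - shade z k|].
Proof.
have const_const (c c' : R) : c = c' \/ 0 < `|c - c'|.
  have [->|cc'] := eqVneq c c'; first by left.
  by right; rewrite normr_gt0 subr_eq0.
have const_profile (c : R) i j : [\/ c = 0, i = j | 0 < `|c| /\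
    forall k, `|c| <= `|c - profile i k| \/ `|c| <= `|c - profile j k|].
  have [->|c0] := eqVneq c 0; first by constructor 1.
  have [->|/eqP ij] := eqVneq i j; first by constructor 2.
  constructor 3; split=> [|k]; first by rewrite normr_gt0.
  by have [->|->] := @profile_disjoint R i j k ij; rewrite subr0 lexx;
    [left|right].
case: x => [c1|[i1 l1]]; case: y => [c2|[i2 l2]]; case: z => [c3|[i3 l3]] /=.
- have [->|d] := const_const (val c1) (val c2); first by left; constructor 1.
  by right; exists `|val c1 - val c2| => // k; constructor 1.
- have [->|d] := const_const (val c1) (val c2); first by left; constructor 1.
  by right; exists `|val c1 - val c2| => // k; constructor 1.
- have [->|d] := const_const (val c1) (val c3); first by left; constructor 2.
  by right; exists `|val c1 - val c3| => // k; constructor 2.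
- have [->|->|[c0 cP]] := const_profile (val c1) i2 i3.
  + left=> k; have [->|] := eqVneq i2 i3; first by constructor 3.
    by move=> /eqP/(@profile_disjoint R _ _ k)[->|->];
      [constructor 1|constructor 2].
  + by left; constructor 3.
  + right; exists `|val c1| => // k.
    by have [|] := cP k; [constructor 1|constructor 2].
- have [->|d] := const_const (val c2) (val c3); first by left; constructor 3.
  by right; exists `|val c2 - val c3| => // k; constructor 3.
- have [->|->|[c0 cP]] := const_profile (val c2) i1 i3.
  + left=> k; have [->|] := eqVneq i1 i3; first by constructor 2.
    by move=> /eqP/(@profile_disjoint R _ _ k)[->|->];
      [constructor 1|constructor 3].
  + by left; constructor 2.
  + right; exists `|val c2| => // k.
    by have [|] := cP k; [rewrite distrC; constructor 1|constructor 3].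
- have [->|->|[c0 cP]] := const_profile (val c3) i1 i2.
  + left=> k; have [->|] := eqVneq i1 i2; first by constructor 1.
    by move=> /eqP/(@profile_disjoint R _ _ k)[->|->];
      [constructor 2|constructor 3].
  + by left; constructor 1.
  + right; exists `|val c3| => // k.
    by have [|] := cP k; rewrite distrC; [constructor 2|constructor 3].
- left=> k.
  have [->|/eqP/(@profile_disjoint R _ _ k) d12] := eqVneq i1 i2.
    by constructor 1.
  have [->|/eqP/(@profile_disjoint R _ _ k) d13] := eqVneq i1 i3.
    by constructor 2.
  have [->|/eqP/(@profile_disjoint R _ _ k) d23] := eqVneq i2 i3.
    by constructor 3.
  case: d12 d13 d23 => p1 [p2|p2] [p3|p3];
    solve [constructor 1; congruence|constructor 2; congruence
          |constructor 3; congruence].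
Qed.

(** In the first case of [shade_triple] the pair minimum tends to 0; in the second the pair maximum
    is eventually at least [r / 2]. *)
Lemma no_scrambled_triple (x : 'I_3 -> strip R) : ~ scrambled advance x.
Proof.
pose a : 'I_3 := ord0; pose b : 'I_3 := lift ord0 ord0.
pose c : 'I_3 := ord_max.
case=> inf0; rewrite ltNge => /negP; apply.
have [xeq|[r r0 xneq]] := shade_triple (x a) (x b) (x c).
  apply/lee_addgt0Pr => e e0; rewrite add0e.
  have [N1 P1] := shade_eq_mdist (x a) (x b) _ e0.
  have [N2 P2] := shade_eq_mdist (x a) (x c) _ e0.
  have [N3 P3] := shade_eq_mdist (x b) (x c) _ e0.
  apply: (limn_esup_le _ _ (N1 + N2 + N3)) => k Nk.
  case: (xeq k) => h.
  - apply: (le_trans (@pair_min_le _ _ _ _ a b isT)); apply: P1 h; lia.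
  - apply: (le_trans (@pair_min_le _ _ _ _ a c isT)); apply: P2 h; lia.
  - apply: (le_trans (@pair_min_le _ _ _ _ b c isT)); apply: P3 h; lia.
have [N1 P1] := shade_neq_mdist (x a) (x b) _ r0.
have [N2 P2] := shade_neq_mdist (x a) (x c) _ r0.
have [N3 P3] := shade_neq_mdist (x b) (x c) _ r0.
have : ((r / 2)%:E <=
    limn_einf (fun k => (pair_max (orbit_tuple advance x k))%:E))%E.
  apply: (le_limn_einf _ _ (N1 + N2 + N3)) => k Nk.
  case: (xneq k) => h.
  - apply: le_trans (@le_pair_max _ _ _ _ a b isT); apply: P1 h; lia.
  - apply: le_trans (@le_pair_max _ _ _ _ a c isT); apply: P2 h; lia.
  - apply: le_trans (@le_pair_max _ _ _ _ b c isT); apply: P3 h; lia.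
by rewrite {}inf0 lee_fin => r20; exfalso; lra.
Qed.

(** * Distribution functions of pairs of orbits *)

Lemma orbits_separated i j (d : R) : i <> j -> d < 1 ->
  limn_einf (fun m => (frequency (fun k =>
    mdist (inr (i, k) : strip R) (inr (j, k)) < d) m : R)%:E) = 0%E.
Proof.
move=> ij d1; apply/eqP; rewrite eq_le; apply/andP; split; last first.
  by apply: (le_limn_einf _ _ 0) => m _; exact: frequency_ge0.
apply/lee_addgt0Pr => e e0; rewrite add0e; apply: limn_einf_le => N.
have [a ea] := exists_natr_gt (2 / e).
have [n [Nn n0 ni]] := logn2_unbounded i (N + a).
have nf0 := fact_gt0 n.
(* At the end of a plateau of label [i], only times before [2 * n!] can be close, a proportion of at
   most [2 / n]. *)
exists (n * n`!)%N; first by nia.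
apply: (@le_trans _ _ ((2 * n`!)%:R / (n * n`!)%:R)).
  apply: frequency_le => k kn; apply: contraTT; rewrite -leqNgt -leNgt => nk.
  have pi : profile i k = 1 :> R.
    by rewrite -ni profile_plateau// nk ltnW.
  have pj : profile j k = 0 :> R.
    by have [/eqP|//] := @profile_disjoint R i j k ij; rewrite pi oner_eq0.
  have := foot_le_mdist (inr (i, k) : strip R) (inr (j, k)).
  by rewrite /= pi pj subr0 normr1; apply/le_trans/ltW.
rewrite !natrM -mulf_div divff ?mulr1 ?pnatr_eq0 -?lt0n//.
rewrite ler_pdivrMr ?ltr0n// -ler_pdivrMl// mulrC.
by rewrite (le_trans (ltW ea))// ler_nat; lia.
Qed.

Lemma orbits_together i j (d : R) : 0 < d ->
  limn_esup (fun m => (frequency (fun k =>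
    mdist (inr (i, k) : strip R) (inr (j, k)) < d) m : R)%:E) = 1%E.
Proof.
move=> d0; apply/eqP; rewrite eq_le; apply/andP; split.
  by apply: (limn_esup_le _ _ 0) => m _; exact: frequency_le1.
apply/lee_subgt0Pr => e e0; rewrite -EFinB; apply: le_limn_esup => N.
have [a ea] := exists_natr_gt e^-1; have [b db] := exists_natr_gt d^-1.
(* The label [i + j + 1] differs from both [i] and [j], so both orbits stay over 0 throughout this
   block. *)
have [n [Nn n0 nl]] := logn2_unbounded (i + j).+1 (N + a + b).
have nf0 := fact_gt0 n.
have ngn := fact_geq n.
(* At the end of the block, the times before it weigh only [n!/(n+1)! = 1/(n+1)]. *)
exists (n.+1`!); first by rewrite factS; nia.
apply: (@le_trans _ _ (1 - n`!%:R / n.+1`!%:R)).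
  rewrite lerB// factS natrM invfM mulrA mulrAC divff ?pnatr_eq0 -?lt0n// mul1r.
  rewrite -[leRHS]invrK lef_pV2 ?posrE ?invr_gt0//.
  by rewrite (le_trans (ltW ea))// ler_nat; lia.
apply: frequency_ge => [|k nk]; first by rewrite nf0 leq_fact.
have pi : profile i k = 0 :> R by apply: (@profile_eq0 _ _ n) => //; lia.
have pj : profile j k = 0 :> R by apply: (@profile_eq0 _ _ n) => //; lia.
apply: (le_lt_trans (mdist_le _ _)); rewrite /= pi pj subrr normr0.
have hd (l : nat) : (l + k).+1%:R^-1 < d.
  rewrite -[ltRHS]invrK ltf_pV2 ?posrE ?invr_gt0//.
  by rewrite (lt_le_trans db)// ler_nat; lia.
by rewrite !gt_max d0 !hd.
Qed.

Lemma diam_strip : @diam R (strip R) = 1%E.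
Proof.
apply/eqP; rewrite eq_le; apply/andP; split.
  by apply: ge_ereal_sup => _ [[x y] _ <-]; rewrite lee_fin mdist_le1.
have i0 : 0 <= (0 : R) <= 1 by rewrite lexx ler01.
have i1 : 0 <= (1 : R) <= 1 by rewrite lexx ler01.
apply: (@le_trans _ _
  (mdist (inl (exist _ 1 i1) : strip R) (inl (exist _ 0 i0)))%:E).
  rewrite lee_fin; apply: le_trans (foot_le_mdist _ _).
  by rewrite /= subr0 normr1.
by apply: ereal_sup_ubound; exists (inl (exist _ 1 i1), inl (exist _ 0 i0)).
Qed.

Definition orbit_starts : set (strip R) := range (fun i => inr (i, 0%N)).

Lemma infinite_orbit_starts : infinite_set orbit_starts.
Proof.
move=> fin; apply: infinite_nat.
have := finite_preimage (f := fun i => inr (i, 0%N) : strip R)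
  (B := orbit_starts) _ fin.
rewrite (_ : _ @^-1` _ = setT); first by apply => i j _ _ [].
by apply/seteqP; split => // i _; exists i.
Qed.

(** The diameter is 1, so extremality is exactly the range [d < 1] of [orbits_separated]. *)
Lemma orbit_starts_scrambled : extremal_dist_scrambled advance 2 orbit_starts.
Proof.
move=> x xS xdiag.
have [i _ xi] := xS ord0; have [j _ xj] := xS ord_max.
have ij : i <> j.
  by move=> eij; apply: xdiag; exists ord0, ord_max; rewrite -xi -xj eij.
have orbE k : (orbit_tuple advance x k ord0 = inr (i, k)) *
              (orbit_tuple advance x k ord_max = inr (j, k)).
  by rewrite /orbit_tuple -xi -xj !iter_advance_inr.
have lower d : d < 1 -> lower_distribution advance x d = 0%E.
  move=> d1; rewrite /lower_distribution -(orbits_separated i j d ij d1).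
  congr limn_einf; apply/funext => m; congr (frequency _ m)%:E.
  by apply/funext => k; rewrite pair_min2 !orbE.
split; last by move=> d; rewrite diam_strip lte_fin; exact: lower.
split=> [d d0|].
  rewrite /upper_distribution -(orbits_together i j d d0).
  congr limn_esup; apply/funext => m; congr (frequency _ m)%:E.
  by apply/funext => k; rewrite pair_max2 !orbE.
exists (1 / 2); rewrite diam_strip lee_fin; split; [lra|lra|].
by apply: lower; lra.
Qed.

End Dynamics.

Theorem theorem1 (R : realType) :
  exists (X : metricType R) (f : X -> X),
    [/\ [set: X] !=set0, compact [set: X], continuous f,
        exists S : set X, infinite_set S /\ extremal_dist_scrambled f 2 S
      & forall x : 'I_3 -> X, ~ scrambled f x].
Proof.
exists (strip R), advance; split.
- by exists (inr (0, 0)%N).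
- exact: strip_compact.
- exact: advance_continuous.
- exists orbit_starts; split; first exact: infinite_orbit_starts.
  exact: orbit_starts_scrambled.
- exact: no_scrambled_triple.
Qed.
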